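(* Let $A$ be a unital Banach algebra and let $a\in A$ be such that $a^{\dag}$ exists. Then the following statements are equivalent: (i) $a$ is EP; (ii) there exists $s\in A$ such that $s^{-1}(0)=0$ and $a^{\dag}=sa$; (iii) there exist $s_1,s_2\in A$ such that $a^{\dag}=s_1a$ and $a=s_2a^{\dag}$; (iv) there exists $u\in A$ such that $uA=A$ and $a^{\dag}=au$; (v) there exist $u_1,u_2\in A$ such that $a^{\dag}=au_1$ and $a=a^{\dag}u_2$; (vi) there exists $t\in A$ such that $t_{-1}(0)=0$ and $a^{\dag}=at$; (vii) there exists $x\in A$ such that $Ax=A$ and $a^{\dag}=xa$; (viii) there exists $v\in A^{-1}$ such that $a^{\dag}a=vaa^{\dag}$; (ix) there exists $v_1\in A$ such that $v_1^{-1}(0)=0$ and $a^{\dag}a=v_1aa^{\dag}$; (x) there exist $v_2,v_3\in A$ such that $a^{\dag}a=v_2aa^{\dag}$ and $aa^{\dag}=v_3a^{\dag}a$; (xi) there exists $w\in A^{-1}$ such that $a^{\dag}a=aa^{\dag}w$; (xii) there exists $w_1\in A$ such that $w_1A=A$ and $a^{\dag}a=aa^{\dag}w_1$; (xiii) there exist $w_2,w_3\in A$ such that $a^{\dag}a=aa^{\dag}w_2$ and $aa^{\dag}=a^{\dag}aw_3$; (xiv) there exist $z_1,z_2\in A$ such that $a^{\dag}a=az_1a^{\dag}$ and $aa^{\dag}=a^{\dag}z_2a$.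
   Context: $A$ is a complex unital Banach algebra; $A^{-1}$ is its set of invertible elements. For $x\in A$: $x^{-1}(0)=\{y\in A: xy=0\}$, $x_{-1}(0)=\{y\in A: yx=0\}$, $xA=\{xy:y\in A\}$, $Ax=\{yx:y\in A\}$. An element $h\in A$ is hermitian if $\|\exp(ith)\|=1$ for all $t\in\mathbb{R}$. The Moore-Penrose inverse of $a\in A$, if it exists, is the (unique) $x\in A$ with $a=axa$, $x=xax$ and $ax$, $xa$ hermitian; it is denoted $a^{\dag}$. An element $a$ is EP if $a^{\dag}$ exists and $aa^{\dag}=a^{\dag}a$. *)

(* Defs.v *)
From HB Require Import structures.
From mathcomp Require Import all_boot all_order all_algebra.
From mathcomp Require Import complex.
From mathcomp Require Import all_classical all_reals topology normedtype.
From mathcomp Require Import sequences.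

Set Implicit Arguments.
Unset Strict Implicit.
Unset Printing Implicit Defensive.

Import Order.TTheory GRing.Theory Num.Theory.
Import numFieldNormedType.Exports.

Local Open Scope classical_set_scope.
Local Open Scope ring_scope.
Local Open Scope complex_scope.

(* A unital Banach algebra cannot be declared as the join of GRing.Algebra and
   CompleteNormedModule: Hierarchy-Builder rejects joins of rings and normed
   groups that are not below Num.NumDomain.  The multiplication is therefore
   part of the mixin, and the algType K structure is derived from it below. *)
HB.mixin Record isBanachAlgebra (K : numFieldType) A
    & CompleteNormedModule K A := {
  banach_one : A ;
  banach_mul : A -> A -> A ;
  banach_mulA : associative banach_mul ;
  banach_mul1l : left_id banach_one banach_mul ;
  banach_mul1r : right_id banach_one banach_mul ;
  banach_mulDl : left_distributive banach_mul +%R ;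
  banach_mulDr : right_distributive banach_mul +%R ;
  banach_scaleAl : forall (k : K) (x y : A),
    k *: banach_mul x y = banach_mul (k *: x) y ;
  banach_scaleAr : forall (k : K) (x y : A),
    k *: banach_mul x y = banach_mul x (k *: y) ;
  banach_normM : forall x y : A, `|banach_mul x y| <= `|x| * `|y| ;
  banach_norm1 : `|banach_one| = 1
}.

(* The norm takes its (real, nonnegative) values in K itself. *)
#[short(type="banachAlgType")]
HB.structure Definition BanachAlgebra (K : numFieldType) :=
  {A of CompleteNormedModule K A & isBanachAlgebra K A}.

Section BanachAlgebraIsAlgebra.
Context (K : numFieldType) (A : banachAlgType K).

Fact banach_one_neq0 : banach_one != 0 :> A.
Proof. by rewrite -normr_eq0 banach_norm1 oner_neq0. Qed.

HB.instance Definition _ := GRing.Zmodule_isNzRing.Build A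
  banach_mulA banach_mul1l banach_mul1r banach_mulDl banach_mulDr
  banach_one_neq0.

HB.instance Definition _ := GRing.Lmodule_isLalgebra.Build K A banach_scaleAl.
HB.instance Definition _ := GRing.Lalgebra_isAlgebra.Build K A banach_scaleAr.

End BanachAlgebraIsAlgebra.

Section BanachAlgebraNotions.
Context {K : numFieldType} {A : banachAlgType K}.
Implicit Types x : A.

Definition banach_exp x : A :=
  limn (series (fun n : nat => (n`!%:R : K)^-1 *: x ^+ n)).

Definition invertible x : Prop := exists y : A, x * y = 1 /\ y * x = 1.

(* x^{-1}(0) *)
Definition right_annihilator x : set A := [set y | x * y = 0].

(* x_{-1}(0) *)
Definition left_annihilator x : set A := [set y | y * x = 0].

(* xA *)
Definition right_multiples x : set A := range (fun y : A => x * y).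

(* Ax *)
Definition left_multiples x : set A := range (fun y : A => y * x).

End BanachAlgebraNotions.

Section MoorePenrose.
Context {R : realType} {A : banachAlgType R[i]}.
Implicit Types a h x : A.

Definition hermitian h : Prop :=
  forall t : R, `|banach_exp ((0 +i* t) *: h)| = 1.

Definition is_moore_penrose_inverse a x : Prop :=
  [/\ a = a * x * a, x = x * a * x, hermitian (a * x) & hermitian (x * a)].

Definition EP a : Prop :=
  exists x, is_moore_penrose_inverse a x /\ a * x = x * a.

End MoorePenrose.

(* Main.v *)
(* For an idempotent p, exp(i pi p) = 1 - 2p, so a hermitian idempotent gives an
   element 1 - 2p of norm 1. If two hermitian idempotents p, q have the same
   range or the same kernel, then (1 - 2p)(1 - 2q) = 1 + 2d with d = q - p or
   d = p - q and d^2 = 0; since (1 + 2d)^n = 1 + 2nd has norm at most 1 for all n,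
   d = 0 and p = q. Each of the listed conditions forces the hermitian idempotents
   a a^dag and a^dag a to have the same range or the same kernel. Conversely, if
   they agree, (a^dag)^2 + 1 - a a^dag is a unit u with a^dag = u a = a u. *)

Require Import Defs.
From mathcomp Require Import all_boot all_order all_algebra.
From mathcomp Require Import complex.
From mathcomp Require Import all_classical all_reals topology normedtype.
From mathcomp Require Import sequences trigo.

Import Order.TTheory GRing.Theory Num.Theory.
Import numFieldNormedType.Exports.

Local Open Scope classical_set_scope.
Local Open Scope ring_scope.

(** * Euler's formula for the exponential series at an imaginary number *)

Lemma cvg_complex (R : realType) (u v : nat -> R) (x y : R) :
  u @ \oo --> x -> v @ \oo --> y ->
  (fun n => (u n +i* v n)%C : R[i]^o) @ \oo --> ((x +i* y)%C : R[i]^o).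
Proof.
move=> ux vy; apply/cvgrPdist_lt => /= e e0.
(* A positive element of [R[i]] is real, so half of its real part can serve as the tolerance for [u]
   and for [v]. *)
have eE : e = (complex.Re e)%:C%C by rewrite RRe_real ?gtr0_real.
have e2 : 0 < complex.Re e / 2 by rewrite divr_gt0// -ltcR -eE.
move/cvgrPdist_lt/(_ _ e2) : ux => ux; move/cvgrPdist_lt/(_ _ e2) : vy => vy.
near=> n.
have -> : (x +i* y)%C - (u n +i* v n)%C
        = (x - u n)%:C%C + 'i%C * (y - v n)%:C%C :> R[i].
  by rewrite [LHS]complexE.
rewrite (le_lt_trans (ler_normD _ _))// normrM !normc_def/=.
rewrite !expr0n/= expr1n !addr0 add0r sqrtr1 mul1r !sqrtr_sqr -rmorphD/= eE ltcR.
by rewrite [complex.Re e]splitr ltrD//; near: n.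
Unshelve. all: by end_near. Qed.

Lemma exp_imaginary_coeff (R : realType) (t : R) n :
  (n`!%:R)^-1 * (0 +i* t)%C ^+ n = (cos_coeff t n +i* sin_coeff t n)%C :> R[i].
Proof.
have -> : (0 +i* t)%C = 'i%C * t%:C%C :> R[i] by rewrite [LHS]complexE /= add0r.
have i2 k : ('i%C : R[i]) ^+ k.*2 = (((-1) ^+ k)%:C)%C.
  by rewrite -mul2n exprM sqr_i rmorphXn/= rmorphN1.
have fE : (n`!%:R : R[i])^-1 = ((n`!%:R : R)^-1)%:C%C.
  by rewrite fmorphV/= rmorph_nat.
rewrite exprMn fE -rmorphXn/= mulrCA -rmorphM/= -{1}(odd_double_half n) exprD i2.
(* The power of ['i] is real for even [n], where [sin_coeff] vanishes, and imaginary for odd [n],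
   where [cos_coeff] does. *)
rewrite /cos_coeff /sin_coeff; case: (boolP (odd n)) => odd_n /=.
  have -> : (n.-1)./2 = n./2.
    by rewrite -{1}(odd_double_half n) odd_n /= doubleK.
  by rewrite odd_n expr1 !mul0r mul1r -mulrA/= [t ^+ n / _]mulrC; simpc.
rewrite (negbTE odd_n) expr0 !mul0r !mul1r -rmorphM/= -exprnP.
by rewrite -mulrA [t ^+ n / _]mulrC.
Qed.

Lemma cvg_exp_imaginary (R : realType) (t : R) :
  series (fun n => (n`!%:R)^-1 * (0 +i* t)%C ^+ n : R[i]^o) @ \oo -->
  ((cos t +i* sin t)%C : R[i]^o).
Proof.
rewrite (_ : series _ =
    fun n => (series (cos_coeff t) n +i* series (sin_coeff t) n)%C).
  by apply: cvg_complex; rewrite unlock;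
    [exact: is_cvg_series_cos_coeff|exact: is_cvg_series_sin_coeff].
apply/funext => n; rewrite /series/=.
elim/big_rec3: _ => // i x y z _ ->.
by rewrite exp_imaginary_coeff; simpc.
Qed.

(** * Rigidity of hermitian idempotents *)

Section HermitianIdempotents.
Context {R : realType} {A : banachAlgType R[i]}.
Implicit Types p q : A.

(** All powers of [p] from the first on equal [p], so the series is scalar except for its constant
    term, which contributes [1 - p]. *)
Lemma banach_exp_idempotent (t : R) p : p * p = p ->
  banach_exp ((0 +i* t)%C *: p) = 1 - p + (cos t +i* sin t)%C *: p.
Proof.
move=> pp; have pX n : p ^+ n.+1 = p.
  by elim: n => [|n IHn]; rewrite ?expr1// exprS IHn.
apply: cvg_lim; first exact: norm_hausdorff.
(* The shift leaves out the empty partial sum, which lacks the constant term and would break the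
   identity below. *)
rewrite -cvg_shiftS.
rewrite (_ : (fun n => _) = fun n => 1 - p +
    series (fun k => (k`!%:R)^-1 * (0 +i* t)%C ^+ k) n.+1 *: p); last first.
  apply/funext => n; rewrite /series/= !big_nat_recl//= !expr0 fact0 invr1 mul1r.
  rewrite scale1r scalerDl scale1r addrA subrK scaler_suml; congr (_ + _).
  by apply: eq_bigr => k _; rewrite exprZn pX scalerA.
apply: cvgD; first exact: cvg_cst.
apply: cvgZr_tmp; rewrite cvg_shiftS; exact: cvg_exp_imaginary.
Qed.

Lemma hermitian_reflection {p} : p * p = p -> Defs.hermitian p -> `|1 - p *+ 2| = 1.
Proof.
have eiN1 : (-1 +i* 0)%C = -1 :> R[i] by simpc.
move=> pp /(_ pi); rewrite banach_exp_idempotent// cospi sinpi eiN1 scaleN1r.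
by rewrite mulr2n opprD addrA.
Qed.

Lemma square_zero_eq0 (d : A) : d * d = 0 -> `|1 + d| <= 1 -> d = 0.
Proof.
move=> dd d1.
have powE n : (1 + d) ^+ n = 1 + d *+ n.
  elim: n => [|n IHn]; first by rewrite expr0 mulr0n addr0.
  rewrite exprS IHn mulrDl mul1r mulrDr mulr1 mulrnAr dd mul0rn addr0.
  by rewrite -addrA -mulrSr.
have pow_le n : `|(1 + d) ^+ n| <= 1.
  elim: n => [|n IHn]; first by rewrite expr0 banach_norm1.
  rewrite exprS (le_trans (banach_normM _ _))//.
  by rewrite -[leRHS]mulr1 ler_pM.
(* The bound comes from writing [d *+ n] as [(1 + d) ^+ n - 1], a difference of two elements of norm
   at most 1. *)
have dn n : `|d| *+ n <= 2.
  rewrite -normrMn -[d *+ n](addKr 1) -powE addrC (le_trans (ler_normB _ _))//.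
  by rewrite [leRHS]mulr2n lerD// ?pow_le// banach_norm1.
apply/eqP; rewrite -normr_eq0; apply/negPn/negP => d0.
(* The norm takes its values in [R[i]]; the archimedean argument is carried out on its real part. *)
have dE : `|d| = (complex.Re `|d|)%:C%C by rewrite RRe_real ?normr_real.
have r0 : 0 < complex.Re `|d|.
  by rewrite -ltcR -dE lt_def d0 normr_ge0.
have := dn (Num.bound (2 / complex.Re `|d|)).
rewrite dE -rmorphMn/= -[2]/(2%:R) -(rmorph_nat (real_complex R)) lecR.
apply/negP; rewrite -ltNge -(mulr_natl (complex.Re _)) -ltr_pdivrMr//.
by rewrite archi_boundP// divr_ge0// ltW.
Qed.

(** The term [4pq] is kept as two halves: once [p * q] reduces to [p] or [q], one half cancels
    against a neighbour. *)
Lemma mul_reflections p q :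
  (1 - p *+ 2) * (1 - q *+ 2) = 1 - p *+ 2 - q *+ 2 + (p * q *+ 2 + p * q *+ 2).
Proof.
rewrite mulrBl mul1r mulrBr mulr1 opprB addrA mulrnAl mulrnAr -mulrnDr.
by rewrite -mulrnA [LHS]addrAC [1 - q *+ 2 - _]addrAC.
Qed.

Lemma reflections_diff_eq0 p q (d : A) : p * p = p -> q * q = q ->
  Defs.hermitian p -> Defs.hermitian q -> d * d = 0 ->
  (1 - p *+ 2) * (1 - q *+ 2) = 1 + d *+ 2 -> d = 0.
Proof.
move=> pp qq hp hq dd E; suff : d *+ 2 = 0.
  by move/eqP; rewrite -scaler_nat scaler_eq0 pnatr_eq0/= => /eqP.
apply: square_zero_eq0; first by rewrite mulrnAl mulrnAr dd !mul0rn.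
rewrite -E (le_trans (banach_normM _ _))//.
by rewrite !hermitian_reflection// mulr1.
Qed.

(** The two product identities encode [pA = qA]; here [d = q - p]. *)
Lemma hermitian_idempotent_range_inj {p q} : p * p = p -> q * q = q ->
  Defs.hermitian p -> Defs.hermitian q -> p * q = q -> q * p = p -> p = q.
Proof.
move=> pp qq hp hq pq qp; apply/esym/eqP; rewrite -subr_eq0; apply/eqP.
apply: (@reflections_diff_eq0 p q) => //.
  by rewrite mulrBl !mulrBr pp qq pq qp subrr.
by rewrite mul_reflections pq addrA subrK addrAC -addrA -mulrnBl.
Qed.

(** The two product identities encode equality of the right annihilators; here [d = p - q]. *)
Lemma hermitian_idempotent_kernel_inj {p q} : p * p = p -> q * q = q ->
  Defs.hermitian p -> Defs.hermitian q -> p * q = p -> q * p = q -> p = q.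
Proof.
move=> pp qq hp hq pq qp; apply/eqP; rewrite -subr_eq0; apply/eqP.
apply: (@reflections_diff_eq0 p q) => //.
  by rewrite mulrBl !mulrBr pp qq pq qp !subrr.
by rewrite mul_reflections pq [1 - _ - _]addrAC addrA subrK addrAC -addrA
  -mulrnBl.
Qed.

End HermitianIdempotents.

(** * Annihilator, multiple and unit conditions reduced to cancellation *)

Section Cancellation.
Context {K : numFieldType} {A : banachAlgType K}.
Implicit Types s u : A.

Lemma right_annihilator0P s : right_annihilator s = [set 0] <-> GRing.lreg s.
Proof.
split=> [s0 y z syz|reg_s].
  apply/eqP; rewrite -subr_eq0; apply/eqP.
  suff: right_annihilator s (y - z) by rewrite s0.
  by rewrite /right_annihilator/= mulrBr syz subrr.
apply/seteqP; split=> y /=; last by move=> ->; rewrite /right_annihilator/= mulr0.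
by rewrite /right_annihilator/= => sy0; apply: reg_s; rewrite sy0 mulr0.
Qed.

Lemma left_annihilator0P s : left_annihilator s = [set 0] <-> GRing.rreg s.
Proof.
split=> [s0 y z ysz|reg_s].
  apply/eqP; rewrite -subr_eq0; apply/eqP.
  suff: left_annihilator s (y - z) by rewrite s0.
  by rewrite /left_annihilator/= mulrBl ysz subrr.
apply/seteqP; split=> y /=; last by move=> ->; rewrite /left_annihilator/= mul0r.
by rewrite /left_annihilator/= => sy0; apply: reg_s; rewrite sy0 mul0r.
Qed.

(** A preimage of 1 is a left inverse of [s], which cancels [s]. *)
Lemma left_multiplesT_lreg s : left_multiples s = [set: A] -> GRing.lreg s.
Proof.
move=> sT y z syz; have [t _ ts] : left_multiples s 1 by rewrite sT.
by rewrite -[y]mul1r -[z]mul1r -ts -!mulrA syz.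
Qed.

Lemma right_multiplesT_rreg s : right_multiples s = [set: A] -> GRing.rreg s.
Proof.
move=> sT y z ysz; have [t _ st] : right_multiples s 1 by rewrite sT.
by rewrite -[y]mulr1 -[z]mulr1 -st !mulrA ysz.
Qed.

Lemma invertible_left_multiplesT u : invertible u -> left_multiples u = [set: A].
Proof.
move=> [w [_ wu]]; apply/seteqP; split=> // y _.
by exists (y * w) => //; rewrite -mulrA wu mulr1.
Qed.

Lemma invertible_right_multiplesT u :
  invertible u -> right_multiples u = [set: A].
Proof.
move=> [w [uw _]]; apply/seteqP; split=> // y _.
by exists (w * y) => //; rewrite mulrA uw mul1r.
Qed.

Lemma invertible_lreg u : invertible u -> GRing.lreg u.
Proof. by move/invertible_left_multiplesT/left_multiplesT_lreg. Qed.

Lemma invertible_rreg u : invertible u -> GRing.rreg u.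
Proof. by move/invertible_right_multiplesT/right_multiplesT_rreg. Qed.

Lemma invertible1 : invertible (1 : A).
Proof. by exists 1; rewrite mulr1. Qed.
End Cancellation.

(** * Uniqueness of the Moore-Penrose inverse and criteria for commutation *)

Section MoorePenroseCommutation.
Context {R : realType} {A : banachAlgType R[i]}.
Implicit Types a b c x y s t u v w z : A.

Lemma moore_penrose_idempotents {a x} : is_moore_penrose_inverse a x ->
  (a * x) * (a * x) = a * x /\ (x * a) * (x * a) = x * a.
Proof. by case=> ax xa _ _; rewrite !mulrA -ax -xa. Qed.

(** Both [a * x] and [a * y] have range [aA], and both [x * a] and [y * a] have the kernel of [a],
    so rigidity identifies each pair. *)
Lemma moore_penrose_unique {a x y} : is_moore_penrose_inverse a x ->
  is_moore_penrose_inverse a y -> x = y.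
Proof.
move=> hx hy.
have [axx xax] := moore_penrose_idempotents hx.
have [ayy yay] := moore_penrose_idempotents hy.
case: hx hy => ax xa hax hxa [ay ya hay hya].
have axy : a * x = a * y.
  by apply: hermitian_idempotent_range_inj => //; rewrite mulrA -?ax -?ay.
have xay : x * a = y * a.
  by apply: hermitian_idempotent_kernel_inj => //;
    rewrite -mulrA [a * (_ * _)]mulrA -?ax -?ay.
by rewrite xa xay -mulrA axy mulrA -ya.
Qed.

Lemma EP_commute {a x} : is_moore_penrose_inverse a x -> EP a <-> a * x = x * a.
Proof.
move=> hx; split=> [[y [hy ayC]]|axC]; last by exists x.
by rewrite (moore_penrose_unique hx hy).
Qed.

Section MoorePenroseInverse.
Context {a x : A} (hx : is_moore_penrose_inverse a x).

Let axa : a * x * a = a. Proof. by case: hx => /esym. Qed.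
Let xax : x * a * x = x. Proof. by case: hx => _ /esym. Qed.
Let axx : (a * x) * (a * x) = a * x.
Proof. by case: (moore_penrose_idempotents hx). Qed.
Let xaa : (x * a) * (x * a) = x * a.
Proof. by case: (moore_penrose_idempotents hx). Qed.

(** The idempotent [c * b] has the kernel of [b], and [c = s * b] vanishes on that kernel. *)
Let left_factor_fix {b c s} : b * c * b = b -> c = s * b -> c * (c * b) = c.
Proof. by move=> bcb cE; rewrite {1}cE -mulrA [b * _]mulrA bcb -cE. Qed.

Let right_factor_fix {b c t} : b * c * b = b -> c = b * t -> b * c * c = c.
Proof. by move=> bcb cE; rewrite {2}cE mulrA bcb -cE. Qed.

Lemma commute_range : a * x * (x * a) = x * a -> x * a * (a * x) = a * x ->
  a * x = x * a.
Proof. by case: hx => _ _ hax hxa; exact: hermitian_idempotent_range_inj. Qed.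

Lemma commute_kernel : a * x * (x * a) = a * x -> x * a * (a * x) = x * a ->
  a * x = x * a.
Proof. by case: hx => _ _ hax hxa; exact: hermitian_idempotent_kernel_inj. Qed.

(** The factorizations give [a] and [x] the same kernel, and these are the kernels of [x * a] and
    [a * x]. *)
Lemma commute_left_factors s1 s2 : x = s1 * a -> a = s2 * x -> a * x = x * a.
Proof.
move=> xE aE; apply: commute_kernel; rewrite -mulrA.
  by rewrite (left_factor_fix axa xE).
by rewrite (left_factor_fix xax aE).
Qed.

Lemma commute_right_factors u1 u2 : x = a * u1 -> a = x * u2 -> a * x = x * a.
Proof.
move=> xE aE; apply: commute_range; rewrite mulrA.
  by rewrite (right_factor_fix axa xE).
by rewrite (right_factor_fix xax aE).
Qed.

(** Cancellation replaces a second factorization: [s * a * (a * x) = x * a * x = x = s * a], whence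
    [a * (a * x) = a]. *)
Lemma commute_lreg_factor s : GRing.lreg s -> x = s * a -> a * x = x * a.
Proof.
move=> reg_s xE; apply: commute_kernel; rewrite -mulrA.
  by rewrite (left_factor_fix axa xE).
by congr (_ * _); apply: reg_s; rewrite /= mulrA -xE mulrA.
Qed.

Lemma commute_rreg_factor t : GRing.rreg t -> x = a * t -> a * x = x * a.
Proof.
move=> reg_t xE; apply: commute_range; rewrite mulrA.
  by rewrite (right_factor_fix axa xE).
by congr (_ * _); apply: reg_t; rewrite /= -mulrA -xE.
Qed.

Lemma commute_lreg_projections v : GRing.lreg v -> x * a = v * (a * x) ->
  a * x = x * a.
Proof.
move=> reg_v E; apply: commute_kernel; last by rewrite E -mulrA axx.
by apply: reg_v; rewrite mulrA -E.
Qed.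

Lemma commute_rreg_projections w : GRing.rreg w -> x * a = a * x * w ->
  a * x = x * a.
Proof.
move=> reg_w E; apply: commute_range; first by rewrite E mulrA axx.
by apply: reg_w; rewrite -mulrA -E.
Qed.

Lemma commute_left_projections v1 v2 :
  x * a = v1 * (a * x) -> a * x = v2 * (x * a) -> a * x = x * a.
Proof.
move=> E1 E2; apply: commute_kernel; first by rewrite E2 -mulrA xaa.
by rewrite E1 -mulrA axx.
Qed.

Lemma commute_right_projections w1 w2 :
  x * a = a * x * w1 -> a * x = x * a * w2 -> a * x = x * a.
Proof.
move=> E1 E2; apply: commute_range; first by rewrite E1 mulrA axx.
by rewrite E2 mulrA xaa.
Qed.

(** The product [x * a * (a * x)] is evaluated twice: [x * a] fixes [x * z2 * a] from the left, and
    [a * x] fixes [a * z1 * x] from the right. *)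
Lemma commute_sandwiched_projections z1 z2 :
  x * a = a * z1 * x -> a * x = x * z2 * a -> a * x = x * a.
Proof.
move=> E1 E2; have <- : x * a * (a * x) = a * x by rewrite E2 !mulrA xax.
by rewrite {1}E1 -!mulrA [x * _]mulrA xax !mulrA -E1.
Qed.

(* [x * x] inverts [a * a] on the range of [a * x]; adding the complementary
   projection makes it a unit of [A]. *)
Lemma commute_unit_factor : a * x = x * a ->
  exists2 u, invertible u & x = u * a /\ x = a * u.
Proof.
move=> axC; exists (x * x + (1 - a * x)); last first.
  split.
    by rewrite mulrDl mulrBl mul1r axa subrr addr0 -mulrA -axC mulrA xax.
  by rewrite mulrDr mulrBr mulr1 mulrA axC xax mulrA axa subrr addr0.
(* Stated for a generic commuting pair because it is applied in both orders, once for each side of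
   the inverse. The cross terms vanish, leaving [b * c + (1 - b * c)]. *)
have inv_mul b c : b * c * b = b -> c * b * c = c -> b * c = c * b ->
    (b * b + (1 - b * c)) * (c * c + (1 - b * c)) = 1.
  move=> bcb cbc bcC.
  have bbc : b * b * c = b by rewrite -mulrA bcC mulrA bcb.
  have bcc : b * c * c = c by rewrite bcC cbc.
  have bb0 : b * b * (1 - b * c) = 0.
    by rewrite -mulrA mulrBr mulr1 mulrA bbc subrr mulr0.
  have cc0 : (1 - b * c) * (c * c) = 0.
    by rewrite mulrA mulrBl mul1r bcc subrr mul0r.
  have bc0 : (1 - b * c) * (1 - b * c) = 1 - b * c.
    by rewrite [LHS]mulrBl mul1r mulrBr mulr1 mulrA bcb subrr subr0.
  rewrite mulrDl !(mulrDr _ (c * c)) bb0 cc0 bc0 addr0 add0r mulrA bbc.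
  by rewrite addrC subrK.
exists (a * a + (1 - a * x)); split; last exact: inv_mul.
by rewrite axC; exact: inv_mul.
Qed.
End MoorePenroseInverse.
End MoorePenroseCommutation.

Theorem theorem4p1 (R : realType) (A : banachAlgType R[i]) (a adag : A)
    (hadag : is_moore_penrose_inverse a adag) :
  [<-> EP a;
       exists s : A, right_annihilator s = [set 0] /\ adag = s * a;
       exists s1 s2 : A, adag = s1 * a /\ a = s2 * adag;
       exists u : A, right_multiples u = [set: A] /\ adag = a * u;
       exists u1 u2 : A, adag = a * u1 /\ a = adag * u2;
       exists t : A, left_annihilator t = [set 0] /\ adag = a * t;
       exists x : A, left_multiples x = [set: A] /\ adag = x * a;
       exists v : A, invertible v /\ adag * a = v * a * adag;
       exists v1 : A, right_annihilator v1 = [set 0] /\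
         adag * a = v1 * a * adag;
       exists v2 v3 : A, adag * a = v2 * a * adag /\ a * adag = v3 * adag * a;
       exists w : A, invertible w /\ adag * a = a * adag * w;
       exists w1 : A, right_multiples w1 = [set: A] /\
         adag * a = a * adag * w1;
       exists w2 w3 : A, adag * a = a * adag * w2 /\ a * adag = adag * a * w3;
       exists z1 z2 : A, adag * a = a * z1 * adag /\ a * adag = adag * z2 * a].
Proof.
(* The definition is symmetric in its two elements, so [a] also factors through [adag]. *)
have hadag' : is_moore_penrose_inverse adag a by case: hadag.
have unit_factor : a * adag = adag * a ->
    exists u : A, [/\ invertible u, adag = u * a & adag = a * u].
  by move/(commute_unit_factor hadag) => [u ? []]; exists u.
have factor : a * adag = adag * a -> exists u : A, a = u * adag /\ a = adag * u.
  by move/esym/(commute_unit_factor hadag') => [u _ []]; exists u.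
have inv1 := @invertible1 _ A.
(* The conditions are proved in a cycle. Nearly every link first derives commutation; the witnesses
   are then the factors above up to (vii), and mostly 1 from (viii) on, where the two projections
   coincide. *)
tfae.
- move/(EP_commute hadag)/unit_factor => [u [/invertible_lreg u_reg uE _]].
  by exists u; split=> //; exact/right_annihilator0P.
- move=> [s [/right_annihilator0P s_reg sE]].
  have C := commute_lreg_factor hadag _ s_reg sE.
  have [[u [_ uE _]] [w [wE _]]] := (unit_factor C, factor C).
  by exists u, w.
- move=> [s1 [s2 [/(commute_left_factors hadag) C /C /unit_factor]]].
  by move=> [u [/invertible_right_multiplesT uT _ uE]]; exists u.
- move=> [u [/right_multiplesT_rreg u_reg uE]].
  have C := commute_rreg_factor hadag _ u_reg uE.
  have [[v [_ _ vE]] [w [_ wE]]] := (unit_factor C, factor C).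
  by exists v, w.
- move=> [u1 [u2 [/(commute_right_factors hadag) C /C /unit_factor]]].
  move=> [u [/invertible_rreg u_reg _ uE]].
  by exists u; split=> //; exact/left_annihilator0P.
- move=> [t [/left_annihilator0P t_reg tE]].
  have [u [/invertible_left_multiplesT uT uE _]] :=
    unit_factor (commute_rreg_factor hadag _ t_reg tE).
  by exists u.
- move=> [x [/left_multiplesT_lreg x_reg xE]].
  exists 1; split; rewrite // mul1r.
  by rewrite (commute_lreg_factor hadag _ x_reg xE).
- move=> [v [/invertible_lreg v_reg vE]]; exists v; split=> //.
  exact/right_annihilator0P.
- move=> [v [/right_annihilator0P v_reg]]; rewrite -mulrA.
  move=> /(commute_lreg_projections hadag _ v_reg) C.
  by exists 1, 1; rewrite !mul1r C.
- move=> [v2 [v3 []]]; rewrite -!mulrA.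
  move=> /(commute_left_projections hadag) C /C {}C.
  by exists 1; rewrite mulr1 C.
- move=> [w [/invertible_rreg w_reg]].
  move=> /(commute_rreg_projections hadag _ w_reg) C.
  by exists 1; rewrite mulr1 C; split=> //; exact: invertible_right_multiplesT.
- move=> [w [/right_multiplesT_rreg w_reg]].
  move=> /(commute_rreg_projections hadag _ w_reg) C.
  by exists 1, 1; rewrite !mulr1 C.
- move=> [w2 [w3 [/(commute_right_projections hadag) C /C {}C]]].
  by exists 1, 1; rewrite !mulr1 C.
- move=> [z1 [z2 [/(commute_sandwiched_projections hadag) C /C {}C]]].
  exact/(EP_commute hadag).
Qed.
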